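(* For every $k\in\mathbb{N}$, the class of graphs of cliquewidth at most $k$ is polynomially $\chi$-bounded; that is, there is a polynomial $f$ (depending on $k$) such that $\chi(G)\leq f(\omega(G))$ for every graph $G$ of cliquewidth at most $k$.
   Context: All graphs are finite and undirected; $\chi(G)$ is the chromatic number and $\omega(G)$ the clique number. A $k$-labelled graph is a graph with a map $\lambda\colon V(G)\to[k]$. Operations on $k$-labelled graphs: for $i\neq j$, $\mathsf{join}_{i,j}$ adds all edges between a vertex of label $i$ and a vertex of label $j$; $\mathsf{rename}_{i\to j}$ changes every label $i$ to $j$; $\mathsf{union}$ takes the disjoint union of two $k$-labelled graphs. The cliquewidth of a graph $G$ is the least $k$ such that some $k$-labelling of $G$ can be built from single-vertex $k$-labelled graphs using these operations. A graph class is polynomially $\chi$-bounded if some polynomial $f$ satisfies $\chi(G)\le f(\omega(G))$ for all graphs $G$ in the class. *)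

(* Defs.v *)
From mathcomp Require Import all_boot all_order all_algebra.
From mathcomp Require Import boolp.

Set Implicit Arguments.
Unset Strict Implicit.
Unset Printing Implicit Defensive.

Record sgraph := SGraph {
  vertex :> finType;
  edge : rel vertex;
  edge_sym : symmetric edge;
  edge_irr : irreflexive edge
}.

Definition graph_iso (G H : sgraph) : Prop :=
  exists2 h : G -> H, bijective h & forall x y, edge (h x) (h y) = edge x y.

Definition colorable (G : sgraph) (n : nat) : bool :=
  [exists c : {ffun G -> 'I_n}, forall x, forall y, edge x y ==> (c x != c y)].

Lemma colorable_card (G : sgraph) : exists n, colorable G n.
Proof.
exists #|G|; apply/existsP; exists [ffun x => enum_rank x].
apply/forallP => x; apply/forallP => y; apply/implyP; rewrite !ffunE.
by apply: contraTneq => /enum_rank_inj ->; rewrite edge_irr.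
Qed.

Definition chromatic_number (G : sgraph) : nat := ex_minn (colorable_card G).

Definition is_clique (G : sgraph) (K : {set G}) : bool :=
  [forall x in K, forall y in K, (x != y) ==> edge x y].

Definition clique_number (G : sgraph) : nat :=
  \max_(K : {set G} | is_clique K) #|K|.

Record lgraph (k : nat) := LGraph {
  graph_of :> sgraph;
  label : graph_of -> 'I_k
}.

Section Operations.
Variable k : nat.

Lemma single_sym : symmetric (fun _ _ : unit => false). Proof. by []. Qed.
Lemma single_irr : irreflexive (fun _ _ : unit => false). Proof. by []. Qed.

Definition single (i : 'I_k) : lgraph k :=
  @LGraph k (SGraph single_sym single_irr) (fun _ => i).

Definition join_edge (i j : 'I_k) (G : lgraph k) : rel G := fun x y =>
  [|| edge x y,
      (label x == i) && (label y == j) | (label x == j) && (label y == i)].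

Lemma join_sym i j G : symmetric (@join_edge i j G).
Proof.
move=> x y; rewrite /join_edge edge_sym; congr (_ || _).
by rewrite orbC andbC; congr (_ || _); rewrite andbC.
Qed.

Lemma join_irr i j G : i != j -> irreflexive (@join_edge i j G).
Proof.
move=> ij x; rewrite /join_edge edge_irr /= [X in _ || X]andbC orbb.
by apply/negbTE; apply: contraNN ij => /andP[/eqP <- /eqP <-].
Qed.

Definition join (i j : 'I_k) (ij : i != j) (G : lgraph k) : lgraph k :=
  @LGraph k (SGraph (@join_sym i j G) (join_irr (G := G) ij)) (@label k G).

Definition rename (i j : 'I_k) (G : lgraph k) : lgraph k :=
  @LGraph k G (fun x => if label x == i then j else label x).

Definition union_edge (G H : sgraph) : rel (G + H)%type := fun u v =>
  match u, v with
  | inl x, inl y => edge x y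
  | inr x, inr y => edge x y
  | _, _ => false
  end.

Lemma union_sym G H : symmetric (@union_edge G H).
Proof. by case=> x [] y //=; apply: edge_sym. Qed.

Lemma union_irr G H : irreflexive (@union_edge G H).
Proof. by case=> x /=; apply: edge_irr. Qed.

Definition union (G H : lgraph k) : lgraph k :=
  @LGraph k (SGraph (@union_sym G H) (@union_irr G H))
    (fun u => match u with inl x => label x | inr y => label y end).

Inductive built : lgraph k -> Prop :=
| built_single i : built (single i)
| built_join i j (ij : i != j) G : built G -> built (join ij G)
| built_rename i j G : i != j -> built G -> built (rename i j G)
| built_union G H : built G -> built H -> built (union G H).

End Operations.

(* The labelling of G is left implicit: it is the one transported from L. *)
Definition constructible (k : nat) (G : sgraph) : Prop :=
  exists2 L : lgraph k, built L & graph_iso L G.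

Lemma built_edgeless k n (f : 'I_n.+1 -> 'I_k) :
  exists L : lgraph k, built L /\ (forall x y : L, edge x y = false) /\
    exists2 h : L -> 'I_n.+1, bijective h & forall x, label x = f (h x).
Proof.
elim: n f => [|n IH] f.
  exists (single (f ord0)); split; first exact: built_single.
  split=> //; exists (fun _ => ord0) => //.
  by exists (fun _ => tt) => [[] //|i]; rewrite [RHS]ord1.
have [L [bL [eL [h [g hK gK] hf]]]] := IH (f \o lift ord0).
exists (union (single (f ord0)) L); split.
  by apply: built_union => //; apply: built_single.
split; first by case=> x [] y //=.
exists (fun u : unit + L =>
    match u with inl _ => ord0 | inr y => lift ord0 (h y) end).
  exists (fun i : 'I_n.+2 =>
      match unlift ord0 i with Some j => inr (g j) | None => inl tt end).
    by case=> [[]|x]; rewrite ?unlift_none ?liftK ?hK.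
  by move=> i; case: unliftP => [j ->|->] //; rewrite gK.
by case=> [[]|x] //=; apply: hf.
Qed.

Lemma constructible_card (G : sgraph) : 0 < #|G| -> constructible #|G| G.
Proof.
have [k kE] : exists k, k = #|G| by exists #|G|.
case: k kE => [|n] kE; first by rewrite -kE.
move=> _; rewrite -kE.
have build (s : seq ('I_n.+1 * 'I_n.+1)) : all (fun p => p.1 != p.2) s ->
  exists L : lgraph n.+1, [/\ built L, bijective (@label _ L) &
    forall x y : L, edge x y =
      ((label x, label y) \in s) || ((label y, label x) \in s)].
  elim: s => [_|[i j] s IH /= /andP[ij /IH[L [bL lL eL]]]].
    have [L [bL [eL [h [g hK gK] hf]]]] := built_edgeless (@id 'I_n.+1).
    exists L; split=> //; exists g => x; by rewrite hf ?hK ?gK.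
  exists (join ij L); split=> //; first exact: built_join.
  move=> x y; rewrite /= /join_edge eL !inE /=.
  by rewrite !xpair_eqE [(label y == i) && _]andbC orbC orbACA.
pose r (i : 'I_n.+1) : G := enum_val (cast_ord kE i).
have rb : bijective r.
  exists (fun x => cast_ord (esym kE) (enum_rank x)) => x.
    by rewrite /r enum_valK cast_ordK.
  by rewrite /r cast_ordKV enum_rankK.
have [|L [bL lL eL]] :=
    build [seq p <- enum {: 'I_n.+1 * 'I_n.+1} | edge (r p.1) (r p.2)].
  apply/allP => -[i j]; rewrite mem_filter => /andP[/= e _].
  by apply: contraTneq e => ->; rewrite edge_irr.
exists L => //; exists (r \o @label _ L); first exact: bij_comp.
move=> x y; rewrite eL mem_filter [X in _ || X]mem_filter !mem_enum !andbT /=.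
by rewrite [edge (r (label y)) _]edge_sym orbb.
Qed.

Lemma cliquewidth_subproof (G : sgraph) :
  exists k, (#|G| == 0) || `[< constructible k G >].
Proof.
exists #|G|; case: (posnP #|G|) => //= G0.
by apply/asboolP/constructible_card.
Qed.

(* The graph without vertices is not constructible for any k; it is given
   cliquewidth 0. *)
Definition cliquewidth (G : sgraph) : nat := ex_minn (cliquewidth_subproof G).

Import GRing.Theory.

Definition poly_chi_bounded (C : sgraph -> Prop) : Prop :=
  exists f : {poly int}, forall G : sgraph, C G ->
    ((chromatic_number G)%:Z <= f.[(clique_number G)%:Z])%R.

(* Main.v *)
(* A construction of G is a rooted tree whose leaves are the vertices: below a
   node x the vertices carry labels, and going from a descendant y up to x
   applies a map of labels.  Induct on the maximal rank r of these maps.  From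
   each node x cut the tree greedily at the first descendants y such that the map
   from y to x has rank < r; contracting the pieces gives a tree with maps of rank
   < r.  Inside the piece of x all maps to x have rank exactly r, hence are
   injective on the labels that occur, so the vertices having a given label at x
   form iterated substitutions of graphs handled before.  Substitution preserves
   the bound chi <= omega^A up to enlarging A, and a piece is a union of boundedly
   many such classes.  Contraction forgets the labels of y as seen from its
   parent; this is repaired by treating separately the edges whose lowest
   common ancestor has even, respectively odd, depth. *)

Require Import Defs.
From mathcomp Require Import all_boot all_order all_algebra.
From mathcomp Require Import boolp zify.

Set Implicit Arguments.
Unset Strict Implicit.
Unset Printing Implicit Defensive.

(** * Arithmetic of powers and of pairs coded as one number *)

Lemma leq_expn m n A : m <= n -> m ^ A <= n ^ A.
Proof. by case: A => // A mn; rewrite leq_exp2r. Qed.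

Lemma pair_code_lt a c m n : a < m -> c < n -> a * n + c < m * n.
Proof.
move=> am cn; apply: (@leq_trans (a.+1 * n)); last by rewrite leq_mul2r am orbT.
by rewrite mulSn addnC ltn_add2r.
Qed.

Lemma pair_code_inj a a' c c' n : c < n -> c' < n ->
  a * n + c = a' * n + c' -> a = a' /\ c = c'.
Proof.
move=> cn cn' E; have n0 : 0 < n by apply: leq_ltn_trans cn.
have Ea : a = a'.
  by have := congr1 (divn^~ n) E; rewrite !divnMDl // !divn_small // !addn0.
by split=> //; move: E; rewrite Ea => /addnI.
Qed.

(** * Colourings, clique numbers and iterated substitution *)

Section Colorings.
Variable V : finType.
Implicit Types (e : rel V) (S U W K : {set V}) (b : V -> {set V}).

Definition colors e U m := exists c : V -> nat,
  {in U, forall u, c u < m} /\ {in U &, forall u v, e u v -> c u != c v}.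

Definition cliqueb e K :=
  [forall u in K, forall v in K, (u != v) ==> e u v].

Definition omega e U := \max_(K : {set V} | (K \subset U) && cliqueb e K) #|K|.

(** The bound is asked of all subsets, which makes it hereditary. *)
Definition chi_exp A e S := forall U, U \subset S -> colors e U (omega e U ^ A).

Lemma cliqueP e K :
  reflect {in K &, forall u v, u != v -> e u v} (cliqueb e K).
Proof.
apply: (iffP forall_inP) => [H u v uK vK|H u uK].
  by move/(_ u uK)/forall_inP/(_ v vK)/implyP: H.
by apply/forall_inP => v vK; apply/implyP; apply: H.
Qed.

Lemma omega_ge e U K : K \subset U -> cliqueb e K -> #|K| <= omega e U.
Proof. by move=> KU cK; apply: leq_bigmax_cond; rewrite KU. Qed.

Lemma omega_le e U n :
  (forall K, K \subset U -> cliqueb e K -> #|K| <= n) -> omega e U <= n.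
Proof. by move=> H; apply/bigmax_leqP => K /andP[]; apply: H. Qed.

Lemma omega_witness e U :
  exists K, [/\ K \subset U, cliqueb e K & #|K| = omega e U].
Proof.
pose P K := (K \subset U) && cliqueb e K.
have P0 : 0 < #|P|.
  apply/card_gt0P; exists set0; rewrite unfold_in /P sub0set /=.
  by apply/cliqueP => u v; rewrite inE.
have [K /andP[KU cK] eK] := eq_bigmax_cond (fun K : {set V} => #|K|) P0.
by exists K; rewrite KU cK -eK.
Qed.

Lemma omega_sub e e' U U' : U \subset U' ->
  {in U &, forall u v, e u v -> e' u v} -> omega e U <= omega e' U'.
Proof.
move=> UU' ee'; apply: omega_le => K KU /cliqueP cK.
apply: omega_ge; first exact: subset_trans UU'.
apply/cliqueP => u v uK vK uv.
by apply: ee'; [apply: (subsetP KU)|apply: (subsetP KU)|apply: cK].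
Qed.

Lemma omega_gt0 e U u : u \in U -> 0 < omega e U.
Proof.
move=> uU; rewrite -(cards1 u) omega_ge ?sub1set //.
by apply/cliqueP => x y /set1P-> /set1P->; rewrite eqxx.
Qed.

Lemma omega_edge e U u v : symmetric e -> irreflexive e ->
  u \in U -> v \in U -> e u v -> 1 < omega e U.
Proof.
move=> se ie uU vU uv.
have nuv : u != v by apply: contraTneq uv => ->; rewrite ie.
have <- : #|[set u; v]| = 2 by rewrite cards2 nuv.
apply: omega_ge; first by rewrite subUset !sub1set uU.
apply/cliqueP => x y /set2P[]-> /set2P[]->; rewrite ?eqxx //.
by rewrite se.
Qed.

Lemma colors_leq e U m m' : m <= m' -> colors e U m -> colors e U m'.
Proof.
move=> mm' [c [cm ce]]; exists c; split=> // u uU.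
exact: leq_trans (cm u uU) mm'.
Qed.

Lemma colors_sub e e' U U' m : U \subset U' ->
  {in U &, forall u v, e u v -> e' u v} -> colors e' U' m -> colors e U m.
Proof.
move=> /subsetP UU' ee' [c [cm ce]]; exists c; split=> [u /UU'/cm//|u v uU vU uv].
by apply: ce; auto.
Qed.

Lemma colors_edgeless e U : {in U &, forall u v, ~~ e u v} -> colors e U 1.
Proof. by move=> eU; exists (fun=> 0); split=> // u v uU vU; rewrite (negbTE (eU _ _ _ _)). Qed.

Lemma colors_omega_small e U A : symmetric e -> irreflexive e ->
  omega e U <= 1 -> colors e U (omega e U ^ A).
Proof.
move=> se ie; case E: (omega e U) => [|[|//]] _; rewrite ?exp1n.
  exists (fun=> 0); suff H u : u \in U -> False by split=> [u /H|u v /H].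
  by move=> /(omega_gt0 e); rewrite E.
apply: colors_edgeless => u v uU vU; apply/negP => uv.
by have := omega_edge se ie uU vU uv; rewrite E.
Qed.

Lemma chi_exp_sub A e e' S S' : S' \subset S ->
  {in S' &, e =2 e'} -> chi_exp A e S -> chi_exp A e' S'.
Proof.
move=> SS' ee' H U US'; have /H : U \subset S by apply: subset_trans SS'.
have eU : {in U &, e =2 e'} by move=> u v uU vU; apply: ee'; apply: (subsetP US').
have <- : omega e U = omega e' U.
  by apply/eqP; rewrite eqn_leq !omega_sub // => u v uU vU; rewrite eU.
by apply: colors_sub => // u v uU vU; rewrite eU.
Qed.

(** Product colouring: the colours for [e0] and [e1] form a pair, coded as one number below
    [n ^ A * n ^ A]. *)
Lemma chi_exp_union A e e0 e1 S :
  (forall u v, e0 u v -> e u v) -> (forall u v, e1 u v -> e u v) ->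
  {in S &, forall u v, e u v -> e0 u v || e1 u v} ->
  chi_exp A e0 S -> chi_exp A e1 S -> chi_exp (2 * A) e S.
Proof.
move=> e0e e1e ee H0 H1 U US.
set n := omega e U.
have ext e' : (forall u v, e' u v -> e u v) -> chi_exp A e' S -> colors e' U (n ^ A).
  move=> e'e /(_ U US); apply: colors_leq.
  by apply: leq_expn; apply: omega_sub => // u v _ _ /e'e.
have [c0 [m0 p0]] := ext _ e0e H0; have [c1 [m1 p1]] := ext _ e1e H1.
exists (fun u => c0 u * n ^ A + c1 u); split=> [u uU|u v uU vU uv].
  by rewrite mul2n -addnn expnD pair_code_lt ?m0 ?m1.
apply/eqP => /pair_code_inj[]; [exact: m1|exact: m1|move=> Ec0 Ec1].
have /orP[/p0|/p1] := ee u v (subsetP US _ uU) (subsetP US _ vU) uv.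
  by move=> /(_ uU vU); rewrite Ec0 eqxx.
by move=> /(_ uU vU); rewrite Ec1 eqxx.
Qed.

Lemma colors_classes (L : finType) (lab : V -> L) e U m :
  (forall i, colors e [set u in U | lab u == i] m) -> colors e U (#|L| * m).
Proof.
move=> /choice[c cP].
exists (fun u => enum_rank (lab u) * m + c (lab u) u); split=> [u uU|u v uU vU uv].
  have [/(_ u)] := cP (lab u); rewrite inE uU eqxx => /(_ isT) cu _.
  by apply: pair_code_lt.
have [/(_ u)] := cP (lab u); rewrite inE uU eqxx => /(_ isT) cu pu.
have [/(_ v)] := cP (lab v); rewrite inE vU eqxx => /(_ isT) cv _.
apply/eqP => /pair_code_inj[//|//|/val_inj/enum_rank_inj Elab Ec].
have := pu u v; rewrite !inE uU vU -Elab eqxx => /(_ isT isT uv).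
by rewrite Ec Elab eqxx.
Qed.

(** When the blocks are modules, this is the quotient with each vertex blown up to an independent
    set. *)
Definition cross e b := [rel u v | e u v && (b u != b v)].

Lemma cross_sym e b : symmetric e -> symmetric (cross e b).
Proof. by move=> se u v; rewrite /= se eq_sym. Qed.

Lemma cross_irr e b : irreflexive (cross e b).
Proof. by move=> u; rewrite /= eqxx andbF. Qed.

Definition blocks b S := {in S, forall u, b u = [set v in S | b v == b u]}.

Lemma mem_block b S u : blocks b S -> u \in S -> u \in b u.
Proof. by move=> bS uS; rewrite bS // inE uS eqxx. Qed.

Lemma block_sub b S u : blocks b S -> u \in S -> b u \subset S.
Proof. by move=> bS uS; rewrite bS //; apply/subsetP => v; rewrite inE => /andP[]. Qed.

Lemma in_block b S u v : blocks b S -> u \in S -> v \in b u -> b v = b u.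
Proof. by move=> bS uS; rewrite {1}bS // inE => /andP[_ /eqP]. Qed.

Lemma blockE b S u v : blocks b S -> u \in S -> v \in S -> (v \in b u) = (b v == b u).
Proof. by move=> bS uS vS; rewrite {1}bS // inE vS. Qed.

(** Iterated substitution: the last condition makes the blocks modules, and singleton blocks are the
    leaves. *)
Inductive modtree A e : {set V} -> Prop :=
| Modtree S b of blocks b S & chi_exp A (cross e b) S
    & {in S, forall u, 1 < #|b u| -> modtree A e (b u)}
    & {in S & &, forall u v w, b u = b v -> b w <> b u -> e u w = e v w} :
  modtree A e S.

Lemma modtree_ext A e e' S : {in S &, e =2 e'} -> modtree A e S -> modtree A e' S.
Proof.
move=> + H; elim: H => {}S b bS gS _ IH mS ee'.
apply: (Modtree (b := b)) => //.
- by apply: chi_exp_sub gS => // u v uS vS /=; rewrite ee'.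
- move=> u uS b1; apply: IH => // v w vb wb.
  by apply: ee'; apply: (subsetP (block_sub bS uS)).
- by move=> u v w uS vS wS uv uw; rewrite -!ee' //; apply: mS.
Qed.

End Colorings.

(* In a substitution with clique number n, blocks of clique number w are grouped
   by q = n %/ w.  For q >= 2 a group gets its own palette, placed at [offset q.+1]:
   a clique meets at most q of its blocks, each of clique number at most n %/ q.
   Blocks with q <= 1, that is n < 2 w, form no edges among themselves and only
   have to avoid the palettes of blocks of clique number at most n - w. *)
Definition palette n A q := q ^ A * (n %/ q) ^ (A + 4).

Definition offset n A j := \sum_(j <= q < n.+1) palette n A q.

Lemma offset_rec n A j : j <= n -> offset n A j = palette n A j + offset n A j.+1.
Proof. by move=> jn; rewrite /offset big_ltn. Qed.

Lemma offset_anti n A j j' : j <= j' -> offset n A j' <= offset n A j.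
Proof.
move=> jj'; case: (leqP j' n.+1) => [j'n|nj'].
  by rewrite /offset (big_cat_nat jj' j'n) leq_addl.
by rewrite {1}/offset big_geq // ltnW.
Qed.

Lemma palette_bound n A q : palette n A q * q ^ 4 <= n ^ (A + 4).
Proof.
rewrite /palette expnD mulnA -mulnA [_ ^ 4 * _]mulnC -expnMn -expnMn.
rewrite expnD; apply: leq_mul; apply: leq_expn.
  by rewrite mulnC leq_trunc_div.
by rewrite mulnC leq_trunc_div.
Qed.

(** With N = [n ^ (A + 4)], a palette has size at most N / q^4, hence at most N / ((q + 1)(q + 2))
    for q >= 2, and these bounds telescope to N / (j + 1). The surplus 4 in the exponent pays for
    this. *)
Lemma offset_bound n A j : 2 <= j -> offset n A j * j.+1 <= n ^ (A + 4).
Proof.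
move=> j2; have [m] := ubnP (n.+1 - j); elim: m => // m IH in j j2 *.
move=> nm; case: (leqP j n) => jn; last by rewrite /offset big_geq.
have /IH H : 2 <= j.+1 by apply: ltnW.
have {}H : offset n A j.+1 * j.+2 <= n ^ (A + 4) by apply: H; lia.
have P := palette_bound n A j; rewrite offset_rec //.
move: (palette n A j) (offset n A j.+1) (n ^ (A + 4)) P H => p o N P H.
have {}P : p * (j.+1 * j.+2) <= N.
  apply: leq_trans P; rewrite leq_mul2l; apply/orP; right.
  rewrite !expnS expn0; nia.
have : (p + o) * j.+1 * j.+2 <= N * j.+2 by nia.
by rewrite leq_pmul2r.
Qed.

(** As [n < (n %/ m).+1 * m], the offset takes at most the fraction m / n of the colours, and the
    power of [n - m] at most the fraction (n - m) / n. In use, [n - m] is the clique number of a big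
    block and [m] bounds that of its neighbours. *)
Lemma offset_big n A m : 0 < m -> 2 * m <= n ->
  offset n A (n %/ m) + (n - m) ^ (A + 4) <= n ^ (A + 4).
Proof.
move=> m0 mn; have j2 : 2 <= n %/ m by rewrite leq_divRL // mulnC mulnC.
have H := offset_bound n A j2; have ltj : n < (n %/ m).+1 * m by apply: ltn_ceil.
have eN x : x ^ (A + 4) = x * x ^ (A + 3) by rewrite addnS expnS.
have le_o : offset n A (n %/ m) <= m * n ^ (A + 3).
  rewrite -(@leq_pmul2r (n %/ m).+1) //; apply: leq_trans H _.
  by rewrite eN mulnAC leq_mul2r [m * _]mulnC (ltnW ltj) orbT.
have le_x : (n - m) ^ (A + 4) <= (n - m) * n ^ (A + 3).
  by rewrite eN leq_mul2l leq_expn ?orbT // leq_subr.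
apply: leq_trans (leq_add le_o le_x) _.
by rewrite -mulnDl subnKC ?eN //; lia.
Qed.

(** * Colouring iterated substitutions *)

Section Substitution.
Variable V : finType.
Implicit Types (e : rel V) (S U W K : {set V}) (b : V -> {set V}).

(** Replace each vertex of [K] by a maximum clique of its block: modules joined by one edge are
    completely joined, so the union is a clique. *)
Lemma sum_omega_blocks e b S K : symmetric e -> blocks b S ->
  {in S & &, forall u v w, b u = b v -> b w <> b u -> e u w = e v w} ->
  K \subset S -> cliqueb (cross e b) K ->
  \sum_(u in K) omega e (b u) <= omega e S.
Proof.
move=> se bS mS /subsetP KS /cliqueP cK.
have [F FP] := choice (fun u => omega_witness e (b u)).
pose G u := if u \in K then F u else set0.
have GP u x : x \in G u -> [/\ u \in K, x \in F u, x \in S & b x = b u].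
  rewrite /G; case: ifP => [uK xF|]; last by rewrite inE.
  have [/subsetP/(_ x xF) xb _ _] := FP u.
  split=> //; last exact: (in_block bS (KS u uK)).
  exact: subsetP (block_sub bS (KS u uK)) _ xb.
have dG u v : u != v -> [disjoint G u & G v].
  move=> uv; apply/pred0P => x /=; apply/negP => /andP[/GP[uK _ _ xu] /GP[vK _ _ xv]].
  by have /= := cK u v uK vK uv; rewrite -xu -xv eqxx andbF.
have -> : \sum_(u in K) omega e (b u) = #|\bigcup_u G u|.
  rewrite -sum1_card partition_disjoint_bigcup // big_mkcond /=.
  apply: eq_bigr => u _; rewrite sum1_card /G.
  by case: ifP => _; [case: (FP u)|rewrite cards0].
apply: omega_ge; first by apply/bigcupsP => u _; apply/subsetP => x /GP[].
apply/cliqueP => x y /bigcupP[u _ xu] /bigcupP[v _ yv] xy.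
have [uK xF xS bx] := GP _ _ xu; have [vK yF yS by_] := GP _ _ yv.
case: (eqVneq u v) => [E|uv].
  by have [_ /cliqueP cF _] := FP u; apply: cF; rewrite ?E // -E.
have /andP[uve bub] := cK u v uK vK uv.
have uS := KS u uK; have vS := KS v vK.
have nb : b u <> b v by apply/eqP.
rewrite (mS x u y) //; last by rewrite bx by_ => /esym.
rewrite se (mS y v u) //; first by rewrite se.
by rewrite by_.
Qed.

(** Induction on the tree with the same exponent [A + 4] at every level, so the bound does not
    depend on the depth: the palettes fit the colourings of the blocks into [n ^ (A + 4)]
    colours. *)
Lemma modtree_colors A e S : symmetric e -> irreflexive e ->
  modtree A e S -> colors e S (omega e S ^ (A + 4)).
Proof.
move=> se ie; elim=> {}S b bS gS _ IH mS.
set n := omega e S; pose w u := omega e (b u).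
have w0 u : u \in S -> 0 < w u by move=> uS; apply/omega_gt0/(mem_block bS).
have wn u : u \in S -> w u <= n by move=> uS; apply: omega_sub => //; apply: block_sub.
have sumw K : K \subset S -> cliqueb (cross e b) K -> \sum_(u in K) w u <= n.
  by move=> KS cK; apply: sum_omega_blocks mS KS cK.
have pairw u v : u \in S -> v \in S -> e u v -> b u != b v -> w u + w v <= n.
  move=> uS vS uv buv; have nuv : u != v by apply: contra_neq buv => ->.
  have := sumw [set u; v]; rewrite big_setU1 ?inE // big_set1; apply.
    by rewrite subUset !sub1set uS.
  apply/cliqueP => x y /set2P[]-> /set2P[]->; rewrite ?eqxx //= => _.
    by rewrite uv.
  by rewrite se uv eq_sym.
have /choice[c cP] (B : {set V}) : exists c : V -> nat, forall u, u \in S -> b u = B ->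
    {in B, forall x, c x < w u ^ (A + 4)} /\ {in B &, forall x y, e x y -> c x != c y}.
  case: (pselect (exists2 u, u \in S & b u = B)); last first.
    by move=> nB; exists (fun=> 0) => u uS uB; case: nB; exists u.
  move=> [u uS uB].
  have [f [f1 f2]] : colors e B (w u ^ (A + 4)).
    case: (ltnP 1 #|b u|) => [b1|]; first by rewrite -uB; apply: IH.
    rewrite uB => B1; apply: (@colors_leq _ _ _ 1); first by rewrite expn_gt0 w0.
    apply: colors_edgeless => x y xB yB; have /card_le1_eqP B1' := B1.
    by rewrite (B1' x y) // ie.
  exists f => v vS vB; have -> : w v = w u by rewrite /w vB uB.
  by split.
(* In group [p] every weight [w u] exceeds n / (p + 1), while the weights along a quotient clique
   sum to at most n; so such a clique has at most [p] vertices. *)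
have /choice[d dP] p : colors (cross e b) [set u in S | n %/ w u == p] (p ^ A).
  set Q := [set u in S | _].
  have QS : Q \subset S by apply/subsetP => u; rewrite inE => /andP[].
  apply: (@colors_leq _ _ _ (omega (cross e b) Q ^ A)); last exact: gS.
  apply: leq_expn; apply: omega_le => K KQ cK; rewrite leqNgt; apply/negP => pK.
  have Kw u : u \in K -> n < p.+1 * w u.
    by move=> /(subsetP KQ); rewrite inE => /andP[uS /eqP<-]; rewrite ltn_ceil ?w0.
  have : #|K| * n.+1 <= \sum_(u in K) p.+1 * w u.
    by rewrite -sum_nat_const; apply: leq_sum => u /Kw.
  rewrite -big_distrr /= => H.
  have := leq_trans H (leq_mul (leqnn _) (sumw K (subset_trans KQ QS) cK)).
  by apply/negP; rewrite -ltnNge; apply: leq_trans (leq_mul pK (leqnn _)); rewrite ltn_mul2l /=.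
pose q u := n %/ w u; pose N u := (n %/ q u) ^ (A + 4).
(* A neighbour outside the block has weight at most [n - w u], so its palette lies below this
   offset. If [w u = n] there is no such neighbour, and the quotient would be a division by zero. *)
pose start u := if w u == n then 0 else offset n A (n %/ (n - w u)).
pose col u := if q u < 2 then start u + c (b u) u
  else offset n A (q u).+1 + (d (q u) u * N u + c (b u) u).
have cN u : u \in S -> c (b u) u < N u.
  move=> uS; have [/(_ u (mem_block bS uS)) cw _] := cP _ u uS erefl.
  apply: leq_trans cw _; apply: leq_expn; rewrite leq_divRL.
    by rewrite mulnC leq_trunc_div.
  by rewrite /q divn_gt0 ?w0 ?wn.
have dq u : u \in S -> d (q u) u < q u ^ A.
  by move=> uS; have [/(_ u)] := dP (q u); rewrite inE uS eqxx => /(_ isT).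
have col_small u : u \in S -> 2 <= q u -> col u < offset n A (q u).
  move=> uS qu; rewrite /col ifN -?leqNgt // (@offset_rec _ _ (q u)) ?leq_div //.
  by rewrite addnC ltn_add2r /palette pair_code_lt ?dq ?cN.
have bigP u : q u < 2 -> u \in S -> n < 2 * w u.
  by move=> qu uS; move: qu; rewrite ltnNge leq_divRL ?w0 // -ltnNge.
have startP u : u \in S -> q u < 2 -> start u + w u ^ (A + 4) <= n ^ (A + 4).
  move=> uS /bigP-/(_ uS) qu; rewrite /start; case: eqP => [->//|/eqP nw].
  have wlt : w u < n by rewrite ltn_neqAle nw wn.
  rewrite -{2}(subKn (wn u uS)); apply: offset_big; lia.
have col_mixed u v : u \in S -> v \in S -> e u v -> b u != b v ->
    q v < 2 <= q u -> col u < col v.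
  move=> uS vS uv nbuv /andP[qv qu]; apply: leq_trans (col_small u uS qu) _.
  have wuv := pairw u v uS vS uv nbuv.
  rewrite /col qv /start; have u0 := w0 u uS.
  case: eqP => [E|/eqP nw]; first by move: wuv; rewrite E; lia.
  apply: leq_trans (leq_addr _ _); apply: offset_anti.
  by apply: leq_div2l => //; lia.
have col_ordered u v : u \in S -> v \in S -> 2 <= q u -> q u < q v -> col v < col u.
  move=> uS vS qu quv; apply: leq_trans (col_small v vS _) _; first by lia.
  rewrite {1}/col ifN -?leqNgt //; apply: leq_trans (leq_addr _ _).
  exact: offset_anti.
exists col; split=> [u uS|u v uS vS uv].
  case: (ltnP (q u) 2) => qu.
    rewrite /col qu; apply: leq_trans (startP u uS qu); rewrite ltn_add2l.
    by have [/(_ u (mem_block bS uS))] := cP _ u uS erefl.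
  apply: leq_trans (col_small u uS qu) _.
  by apply: leq_trans (offset_bound n A qu); rewrite leq_pmulr.
case: (eqVneq (b u) (b v)) => buv.
  have cuv : c (b u) u != c (b u) v.
    have [_] := cP _ u uS erefl; apply=> //; first exact: mem_block bS uS.
    by rewrite buv; apply: mem_block bS vS.
  have wE : w u = w v by rewrite /w buv.
  have qE : q u = q v by rewrite /q wE.
  rewrite /col /start /N qE wE -buv; case: ifP => _; first by rewrite eqn_add2l.
  rewrite eqn_add2l; apply/eqP => /pair_code_inj[||_ /eqP]; last by apply/negP.
    by have := cN u uS; rewrite /N qE.
  by have := cN v vS; rewrite /N -buv.
case: (ltnP (q u) 2) => qu; case: (ltnP (q v) 2) => qv.
- have := pairw u v uS vS uv buv; move: qu qv.
  by move=> /bigP-/(_ uS) qu /bigP-/(_ vS) qv; lia.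
- by rewrite gtn_eqF // col_mixed ?qu // 1?se // eq_sym.
- by rewrite ltn_eqF // col_mixed ?qv.
case: (ltngtP (q u) (q v)) => quv.
- by rewrite gtn_eqF ?col_ordered.
- by rewrite ltn_eqF ?col_ordered.
rewrite /col ifN -?leqNgt // /N quv ifN -?leqNgt // eqn_add2l.
apply/eqP => /pair_code_inj[||dE _].
- by have := cN u uS; rewrite /N quv.
- exact: cN.
have [_ /(_ u v)] := dP (q v); rewrite !inE uS vS -/(q u) -/(q v) quv eqxx.
by move=> /(_ isT isT)/=; rewrite uv buv dE eqxx => /(_ isT).
Qed.
End Substitution.

(** * Trees with relabelling maps, and contraction of pieces of constant rank *)

Section Decompositions.
Variables (V L : finType).
Implicit Types (e : rel V) (S U W B K : {set V}) (b : V -> {set V}).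
Implicit Types (lam : V -> L) (h p f : L -> L).

Lemma blocks_refine b S (I : pred {set V}) (bb : {set V} -> V -> {set V}) :
  blocks b S -> {in S, forall u, I (b u) -> blocks (bb (b u)) (b u)} ->
  blocks (fun u => if I (b u) then bb (b u) u else b u) S.
Proof.
move=> bS bbP; set b2 := fun u => _.
have sub u : u \in S -> u \in b2 u /\ b2 u \subset b u.
  move=> uS; rewrite /b2; have ub := mem_block bS uS.
  case: ifP => // Iu; split; first exact: mem_block (bbP u uS Iu) ub.
  exact: block_sub (bbP u uS Iu) ub.
move=> u uS; apply/setP => v; rewrite inE.
case: (boolP (v \in S)) => vS /=; last first.
  apply: contraNF vS => /(subsetP (sub u uS).2).
  exact: subsetP (block_sub bS uS) v.
case: (eqVneq (b v) (b u)) => buv.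
  rewrite /b2 buv; have vb : v \in b u by rewrite (blockE bS) // buv.
  case: ifP => Iu; last by rewrite eqxx.
  by rewrite (blockE (bbP u uS Iu)) // (mem_block bS).
have nv : v \notin b u by rewrite (blockE bS).
rewrite (contraNF (subsetP (sub u uS).2 v) nv); apply/esym.
apply: contraNF nv => /eqP E; apply: (subsetP (sub u uS).2).
by rewrite -E; case: (sub v vS).
Qed.

Definition rank h := #|[set h x | x in L]|.

(** [f] does not shrink the image of [h], hence is injective on it. *)
Lemma rank_comp_inj f h x y : rank h <= rank (f \o h) -> f (h x) = f (h y) -> h x = h y.
Proof.
move=> le_r; have /imset_injP inj : #|[set f z | z in [set h z | z in L]]| == #|[set h z | z in L]|.
  by rewrite eqn_leq leq_imset_card -imset_comp.
by apply: inj; apply: imset_f.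
Qed.

(* [h] relabels the child B into its parent S; the edges leaving B inside S are
   governed by the value of [p] on the labels of B. *)
Definition link (Q : (L -> L) -> (L -> L) -> Prop) e S lam B lam' h p :=
  [/\ Q h p, {in B, forall v, lam v = h (lam' v)} &
    forall v v' w, v \in B -> v' \in B -> w \in S -> w \notin B ->
      p (lam' v) = p (lam' v') -> e v w = e v' w].

(* The data of a block is only constrained when the block has at least two elements: the
   singleton blocks are the leaves. *)
Inductive dec (Q : (L -> L) -> (L -> L) -> Prop) A e : {set V} -> (V -> L) -> Prop :=
| Dec S lam b (lamB : {set V} -> V -> L) (h p : {set V} -> L -> L) of
      blocks b S & chi_exp A (cross e b) S
    & {in S, forall u, 1 < #|b u| ->
        link Q e S lam (b u) (lamB (b u)) (h (b u)) (p (b u))}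
    & {in S, forall u, 1 < #|b u| -> dec Q A e (b u) (lamB (b u))} :
  dec Q A e S lam.

Lemma dec_intro Q A e S lam b : blocks b S -> chi_exp A (cross e b) S ->
  {in S, forall u, 1 < #|b u| -> exists lam' h p,
    link Q e S lam (b u) lam' h p /\ dec Q A e (b u) lam'} ->
  dec Q A e S lam.
Proof.
move=> bS gS H.
have /choice[F FP] B : exists t : (V -> L) * (L -> L) * (L -> L),
    (exists u, [/\ u \in S, b u = B & 1 < #|B|]) ->
    link Q e S lam B t.1.1 t.1.2 t.2 /\ dec Q A e B t.1.1.
  case: (pselect (exists u, [/\ u \in S, b u = B & 1 < #|B|])) => [[u [uS uB B1]]|nB].
    have [|lam' [h [p H']]] := H u uS; first by rewrite uB.
    by exists (lam', h, p); rewrite -uB.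
  by exists (lam, id, id) => /nB.
apply: (Dec (b := b) (lamB := fun B => (F B).1.1) (h := fun B => (F B).1.2)
          (p := fun B => (F B).2)) => // u uS u1.
  by case: (FP (b u)) => //; exists u.
by case: (FP (b u)) => //; exists u.
Qed.

Lemma dec_ext Q A e e' S lam : {in S &, e =2 e'} -> dec Q A e S lam -> dec Q A e' S lam.
Proof.
move=> + H; elim: H => {}S {}lam b lamB h p bS gS lS _ IH ee'.
apply: (Dec (b := b) (lamB := lamB) (h := h) (p := p)) => //.
- by apply: chi_exp_sub gS => // u v uS vS /=; rewrite ee'.
- move=> u uS u1; have [Qu lu tu] := lS u uS u1; split=> // v v' w vb vb' wS wb E.
  have sb := subsetP (block_sub bS uS).
  rewrite -(ee' v w (sb v vb) wS) -(ee' v' w (sb v' vb') wS); exact: tu.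
- move=> u uS u1; apply: IH => // v w vb wb.
  by apply: ee'; apply: (subsetP (block_sub bS uS)).
Qed.

(* In [pre] trees edges depend on the labels at the children.  In [mid] trees they
   depend on a coarser label, through which the relabelling factors; this is what
   contracting every second level of a [pre] tree yields. *)
Definition pre r h p := p = id /\ rank h <= r.

Definition mid r h p := rank p <= r /\ exists f, h = f \o p.

(* The piece at the root S, viewed from above through [f]: [b] consists of the
   topmost descendants at which the rank has dropped. *)
Definition cut r A A' e S lam f := exists b, [/\ blocks b S,
  {in S, forall u, 1 < #|b u| -> exists lam' h,
    link (pre r) e S (f \o lam) (b u) lam' h id /\ dec (pre r) A' e (b u) lam'} &
  forall W, W \subset S -> {in W &, forall u v, f (lam u) = f (lam v)} ->
    modtree A (cross e b) W].

(** Each label class of the quotient is an iterated substitution, coloured with exponent [A + 4].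
    Using separate colours for the classes costs a factor [#|L|], which is below [omega ^ #|L|] once
    the clique number is at least 2. *)
Lemma cut_dec r A e S lam : symmetric e ->
  cut r A (A + 4 + #|L|) e S lam id -> dec (pre r) (A + 4 + #|L|) e S lam.
Proof.
move=> se [b [bS H M]]; apply: (dec_intro bS); last first.
  by move=> u uS /(H u uS)[lam' [h H']]; exists lam', h, id.
move=> U US; set q := cross e b.
have sq : symmetric q by apply: cross_sym.
have iq : irreflexive q by apply: cross_irr.
case: (leqP (omega q U) 1) => w1; first exact: colors_omega_small.
apply: (@colors_leq _ _ _ (#|L| * omega q U ^ (A + 4))).
  by rewrite (expnD _ (A + 4)) mulnC leq_mul2l ltnW ?orbT // ltn_expl.
apply: (@colors_classes _ _ lam) => i; set W := [set u in U | _].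
have WU : W \subset U by apply/subsetP => u; rewrite inE => /andP[].
apply: (@colors_leq _ _ _ (omega q W ^ (A + 4))).
  by apply/leq_expn/omega_sub.
apply: modtree_colors => //; apply: M; first exact: subset_trans US.
by move=> u v; rewrite !inE => /andP[_ /eqP->] /andP[_ /eqP->].
Qed.

(** Induction on the tree for all [f] at once, [f] being the composite relabelling up to the root of
    the piece. A block stays in the piece while [f \o h] has rank above [r]. Since this map factors
    through [p], of rank at most [r.+1], equal labels at the root then force equal values of [p], so
    such vertices are twins seen from outside the block. *)
Lemma mid_cut r A e S lam : symmetric e -> dec (mid r.+1) A e S lam ->
  forall f, cut r A (A + 4 + #|L|) e S lam f.
Proof.
move=> se; elim=> {}S {}lam b0 lamB h p bS gS lS _ IH f.
pose I B := (1 < #|B|) && (r < rank (f \o h B)).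
have /choice[bb bbP] B : exists b', (exists2 u, u \in S & b0 u = B) -> I B ->
  [/\ blocks b' B,
  {in B, forall u, 1 < #|b' u| -> exists lam' h',
    link (pre r) e B ((f \o h B) \o lamB B) (b' u) lam' h' id /\
    dec (pre r) (A + 4 + #|L|) e (b' u) lam'} &
  forall W, W \subset B -> {in W &, forall u v, f (h B (lamB B u)) = f (h B (lamB B v))} ->
    modtree A (cross e b') W].
  case: (pselect ((exists2 u, u \in S & b0 u = B) /\ I B)) => [[[u uS uB] IB]|nB].
    have [|b' H] := IH u uS _ (f \o h B); first by rewrite uB; case/andP: IB.
    by exists b' => _ _; rewrite uB in H.
  by exists (fun=> set0) => uB IB; case: nB.
have {}bbP u : u \in S -> I (b0 u) -> _ := fun uS Iu => bbP _ (ex_intro2 _ _ u uS erefl) Iu.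
have inj u x y : u \in S -> I (b0 u) ->
    f (h (b0 u) x) = f (h (b0 u) y) -> p (b0 u) x = p (b0 u) y.
  move=> uS /andP[u1 Iu] E; have [[rp [f0 hE]] _ _] := lS u uS u1.
  apply: (@rank_comp_inj (f \o f0)); last by move: E; rewrite hE.
  by apply: leq_trans rp _; move: Iu; rewrite hE.
pose b u := if I (b0 u) then bb (b0 u) u else b0 u.
have bSb : blocks b S by apply: blocks_refine => // u uS Iu; case: (bbP u uS Iu).
exists b; split=> //.
  move=> u uS; rewrite /b; case: ifPn => Iu u1.
    have [b'B H _] := bbP u uS Iu; have ub := mem_block bS uS.
    have [lam' [h' [[Qh lE tw] D]]] := H u ub u1.
    have /andP[u1' _] := Iu; have [_ lE0 tw0] := lS u uS u1'.
    have sb := subsetP (block_sub b'B ub).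
    exists lam', h'; split=> //; split=> [//|v vb /=|v v' w vb vb' wS wb E].
      by rewrite lE0 ?sb //; apply: lE.
    (* Inside [b0 u] the cut of the child applies; outside, adjacency depends on [p], which the
       labels at the root determine. *)
    case: (boolP (w \in b0 u)) => wB; first exact: tw.
    apply: tw0 => //; try exact: sb.
    by apply: inj => //; have /= := lE v vb; have /= := lE v' vb'; rewrite E => -> ->.
  have [Qh lE tw] := lS u uS u1.
  (* The rank has dropped, so the piece ends here; the block starts a new piece, cut with
     [f = id]. *)
  exists (lamB (b0 u)), (f \o h (b0 u)); split; last exact/cut_dec/IH.
  split=> [|v vb /=|v v' w vb vb' wS wb E].
  - by split=> //; move: Iu; rewrite /I u1 /= -leqNgt.
  - by rewrite lE.
  - by apply: tw => //; rewrite E.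
move=> W WS Wf; have WS' := subsetP WS.
have bref u v : u \in S -> v \in S -> b u = b v -> b0 u = b0 v.
  move=> uS vS E; apply: (in_block bS) => //.
  have ub : u \in b v by rewrite -E; apply: mem_block bSb uS.
  move: ub; rewrite /b; case: ifP => // Iv.
  by have [b'B _ _] := bbP v vS Iv; apply/(subsetP (block_sub b'B _))/(mem_block bS).
(* A block cut off here has no [cross e b] edges inside, so its vertices can be leaves. *)
pose b2 u := if I (b0 u) then b0 u :&: W else [set u].
have b2W : blocks b2 W.
  move=> u uW; have uS := WS' u uW; apply/setP => v; rewrite !inE.
  case: (boolP (v \in W)) => vW /=; last first.
    rewrite /b2; case: ifP => _; first by rewrite inE (negbTE vW) andbF.
    by rewrite inE; apply: contraNF vW => /eqP->.
  have vS := WS' v vW; have vb : v \in b2 v.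
    by rewrite /b2; case: ifP => _; rewrite inE ?eqxx // vW andbT (mem_block bS).
  apply/idP/eqP => [|<-//]; rewrite {1}/b2; case: ifPn => [Iu|nIu].
    by rewrite inE => /andP[/(in_block bS uS) E _]; rewrite /b2 E Iu.
  by move=> /set1P->.
have crossE : {in W &, cross e b0 =2 cross (cross e b) b2}.
  move=> u v uW vW /=; have uS := WS' u uW; have vS := WS' v vW.
  case: (eqVneq (b0 u) (b0 v)) => [E|nE] /=.
    rewrite andbF; apply/esym/negbTE; rewrite /b /b2 -E.
    by case: ifPn => Iu; rewrite ?eqxx ?andbF.
  have -> : b u != b v by apply: contra_neq nE; apply: bref.
  suff -> : b2 u != b2 v by rewrite !andbT.
  apply: contra_neq nE => E; apply: (in_block bS) => //.
  have : u \in b2 v by rewrite -E; apply: mem_block b2W uW.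
  by rewrite /b2; case: ifP => _; [case/setIP|move/set1P->; apply: mem_block bS vS].
apply: (Modtree (b := b2)) => //.
- exact: chi_exp_sub crossE gS.
- move=> u uW; have uS := WS' u uW; rewrite /b2; case: ifP => [Iu _|]; last by rewrite cards1.
  have [b'B _ M] := bbP u uS Iu; have sb := block_sub bS uS.
  have /andP[u1 _] := Iu; have [_ lE _] := lS u uS u1.
  apply: (@modtree_ext _ _ (cross e (bb (b0 u)))).
    move=> v w /setIP[vb vW] /setIP[wb wW] /=.
    by rewrite /b (in_block bS uS vb) (in_block bS uS wb) Iu.
  apply: M; first exact: subsetIl.
  move=> v w /setIP[vb vW] /setIP[wb wW]; rewrite -!lE //; exact: Wf.
move=> u v w uW vW wW uv uw; have uS := WS' u uW; have vS := WS' v vW; have wS := WS' w wW.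
have vb2 : v \in b2 u by rewrite uv; apply: mem_block b2W vW.
move: vb2; rewrite {1}/b2; case: ifP => [Iu|_]; last by move/set1P->.
move=> /setIP[vb _]; have vE := in_block bS uS vb.
have nw : b0 w != b0 u.
  by apply/eqP => E; apply: uw; rewrite /b2 E Iu.
have nb x : x \in S -> b0 x = b0 u -> b x != b w.
  by move=> xS xE; apply: contra_neq nw => E; rewrite -xE; apply/esym/bref.
have /andP[u1 _] := Iu; have [_ lE tw] := lS u uS u1.
rewrite /= !nb // !andbT; apply: tw => //; first exact: mem_block bS uS.
  by rewrite (blockE bS).
apply: inj => //; rewrite -!lE //; [exact: Wf|exact: mem_block bS uS].
Qed.

End Decompositions.

(** * Splitting the edges by the parity of the depth of the lowest common ancestor *)

Section Parity.
Variables (V L : finType).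
Implicit Types (e : rel V) (S U W B K : {set V}) (b : V -> {set V}).
Implicit Types (lam : V -> L) (h p f : L -> L).

(** The odd part keeps its first level [b] explicit, so that the parent of [S] can take these blocks
    as its own. *)
Definition odd_dec r A e S lam b := [/\ blocks b S,
  {in S &, forall u v, b u != b v -> ~~ e u v} &
  {in S, forall u, 1 < #|b u| -> exists lam' h, [/\ rank h <= r,
    {in b u, forall v, lam v = h (lam' v)} & dec (mid r) A e (b u) lam']}].

(** [e0] and [e1] hold the edges whose lowest common ancestor has even, respectively odd, depth
    below [S]. *)
Definition parity_split r A e S lam (e0 e1 : rel V) b :=
  [/\ symmetric e0, symmetric e1,
      (forall u v, e0 u v -> e u v) /\ (forall u v, e1 u v -> e u v),
      {in S &, forall u v, e u v -> e0 u v || e1 u v} &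
      dec (mid r) A e0 S lam /\ odd_dec r A e1 S lam b].

(** No edge leaves a block, so [h] itself can serve as the coarser label. *)
Lemma odd_dec_mid r A e S lam b : odd_dec r A e S lam b -> dec (mid r) A e S lam.
Proof.
move=> [bS eb H]; apply: (dec_intro bS).
  (* One colour suffices, and none for empty [U], where [0 ^ A] may be 0. *)
  move=> U US; apply: (@colors_leq _ _ _ (0 < #|U|)).
    case: (posnP #|U|) => // /card_gt0P[u uU].
    by rewrite expn_gt0 (omega_gt0 _ uU).
  case: (posnP #|U|) => [/eqP|_].
    rewrite cards_eq0 => /eqP->; exists (fun=> 0).
    by split=> [u|u v]; rewrite inE.
  apply: colors_edgeless => u v uU vU /=; apply/negP => /andP[uv buv].
  by have := eb u v (subsetP US _ uU) (subsetP US _ vU) buv; rewrite uv.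
move=> u uS u1; have [lam' [h [rh lE D]]] := H u uS u1.
exists lam', h, h; split=> //; split=> //; first by split=> //; exists id.
move=> v v' w vb vb' wS wb _; have sb := subsetP (block_sub bS uS).
have nb x : x \in b u -> ~~ e x w.
  move=> xb; apply: eb => //; first exact: sb.
  by rewrite (in_block bS uS xb) eq_sym -(blockE bS).
by rewrite (negbTE (nb v vb)) (negbTE (nb v' vb')).
Qed.

(** Edges between children of [S] go to [e0]; inside a child the even and odd parts swap roles. *)
Lemma pre_parity r A e S lam : symmetric e -> irreflexive e ->
  dec (pre r) A e S lam -> exists e0 e1 b, parity_split r A e S lam e0 e1 b.
Proof.
move=> se ie; elim=> {}S {}lam b lamB h p bS gS lS _ IH.
pose I B := 1 < #|B|.
have /choice[F FP] B : exists t : rel V * rel V * (V -> {set V}),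
    [/\ symmetric t.1.1, symmetric t.1.2,
      (forall u v, t.1.1 u v -> e u v) /\ (forall u v, t.1.2 u v -> e u v) &
    (exists2 u, u \in S & b u = B) -> I B ->
      parity_split r A e B (lamB B) t.1.1 t.1.2 t.2].
  case: (pselect ((exists2 u, u \in S & b u = B) /\ I B)) => [[[u uS uB] IB]|nB].
    have [|e0 [e1 [b' H]]] := IH u uS; first by rewrite uB.
    rewrite uB in H; exists (e0, e1, b'); have [? ? ? _ _] := H; split=> //.
  by exists ((fun _ _ => false), (fun _ _ => false), b); split=> // uB IB; case: nB.
pose e0 : rel V := fun u v => if b u == b v then (F (b u)).1.2 u v else e u v.
pose e1 : rel V := fun u v => (b u == b v) && (F (b u)).1.1 u v.
have FS u : u \in S -> I (b u) -> _ := fun uS Iu =>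
  let: And4 _ _ _ H := FP (b u) in H (ex_intro2 _ _ u uS erefl) Iu.
have e0B u : u \in S -> {in b u &, (F (b u)).1.2 =2 e0}.
  move=> uS v w vb wb.
  by rewrite /e0 /= (in_block bS uS vb) (in_block bS uS wb) eqxx.
have e1B u : u \in S -> {in b u &, (F (b u)).1.1 =2 e1}.
  move=> uS v w vb wb.
  by rewrite /e1 /= (in_block bS uS vb) (in_block bS uS wb) eqxx.
(* These blocks are the grandchildren of [S]. *)
pose b2 u := if I (b u) then (F (b u)).2 u else b u.
have b2S : blocks b2 S.
  apply: (@blocks_refine _ b S I (fun B => (F B).2)) => // u uS Iu.
  by have [_ _ _ _ [_ []]] := FS u uS Iu.
have I1 u v : u \in S -> v \in S -> e u v -> b u = b v -> I (b u).
  move=> uS vS uv E; apply/card_gt1P; exists u, v.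
  rewrite (mem_block bS uS) (blockE bS) // E eqxx; split=> //.
  by apply: contraTneq uv => ->; rewrite ie.
exists e0, e1, b; split.
- move=> u v; rewrite /e0 /= [b v == _]eq_sym; case: eqP => [->|_]; last exact: se.
  by have [_ s _ _] := FP (b v); apply: s.
- move=> u v; rewrite /e1 /= [b v == _]eq_sym; case: eqP => [->|//] /=.
  by have [s _ _ _] := FP (b v); apply: s.
- split=> u v; rewrite /e0 /e1 /=; have [_ _ [s0 s1] _] := FP (b u).
    by case: ifP => // _; apply: s1.
  by case/andP => _; apply: s0.
- move=> u v uS vS uv; rewrite /e0 /e1 /=; case: eqP => [E|_] /=; last by rewrite uv.
  have vb : v \in b u by rewrite (blockE bS) // E.
  have Iu := I1 u v uS vS uv E.
  by have [_ _ _ H _] := FS u uS Iu; rewrite orbC H // (mem_block bS).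
split; last first.
  split=> //; first by move=> u v uS vS; rewrite /e1 /= => /negbTE->.
  move=> u uS u1; have [[_ rh] lE _] := lS u uS u1.
  exists (lamB (b u)), (h (b u)); split=> //.
  by have [_ _ _ _ [D _]] := FS u uS u1; apply: dec_ext (e1B u uS) D.
have bref u v : u \in S -> v \in S -> b2 u = b2 v -> b u = b v.
  move=> uS vS E; apply: (in_block bS) => //.
  have : u \in b2 v by rewrite -E; apply: mem_block b2S uS.
  rewrite /b2; case: ifP => // Iv; have [_ _ _ _ [_ [b'B _ _]]] := FS v vS Iv.
  exact: (subsetP (block_sub b'B (mem_block bS vS))).
have e0_odd u v : u \in S -> v \in S -> b u = b v -> b2 u != b2 v -> e0 u v = false.
  move=> uS vS E; rewrite /b2 -E; case: ifP => [Iu nb|_]; last first.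
    by rewrite E eqxx.
  have [_ _ _ _ [_ [_ nF _]]] := FS u uS Iu.
  rewrite /e0 /= E eqxx -E; apply/negbTE/nF => //; first exact: mem_block bS uS.
  by rewrite (blockE bS) // E.
apply: (dec_intro b2S).
  apply: chi_exp_sub gS => // u v uS vS /=.
  case: (eqVneq (b u) (b v)) => [E|nE].
    rewrite andbF; apply/esym/negbTE; case: eqVneq => [_|nb]; first by rewrite andbF.
    by have := e0_odd u v uS vS E nb; rewrite /e0 /= E eqxx => ->.
  by rewrite /e0 (negbTE nE) (_ : b2 u != b2 v) //; apply: contra_neq nE; apply: bref.
move=> u uS; have ub := mem_block bS uS; rewrite {1}/b2; case: ifPn => [Iu b2u|+ u1]; last first.
  by rewrite /I u1.
have b2E : b2 u = (F (b u)).2 u by rewrite /b2 Iu.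
have [_ _ _ _ [_ [b'B nF H]]] := FS u uS Iu.
have [lam' [h' [rh lE D]]] := H u ub b2u.
have sb := subsetP (block_sub b'B ub).
have [[pE rhB] lE0 tw] := lS u uS Iu.
(* Towards vertices outside the child, adjacency depends on the label at the child, which is the
   value of [h']; towards the rest of the child, [e0] has no edges. *)
exists lam', (h (b u) \o h'), h'; rewrite b2E; split; last first.
  apply: dec_ext D => v w vb wb; apply: (e0B u uS); exact: sb.
split=> [|v vb /=|v v' w vb vb' wS wb E].
- by split=> //; exists (h (b u)).
- by rewrite lE0 ?lE //; apply: sb.
have vS := subsetP (block_sub bS uS) v (sb v vb).
have v'S := subsetP (block_sub bS uS) v' (sb v' vb').
have bv := in_block bS uS (sb v vb); have bv' := in_block bS uS (sb v' vb').
have b2v x : x \in S -> x \in (F (b u)).2 u -> b2 x != b2 w.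
  move=> xS xb; rewrite (in_block b2S uS) ?b2E // -b2E eq_sym -(blockE b2S) //.
  by rewrite b2E.
case: (eqVneq (b w) (b u)) => bw.
  by rewrite !e0_odd ?b2v // ?bv ?bv'.
rewrite /e0 /= bv bv' eq_sym (negbTE bw); apply: tw => //; try exact: sb.
  by rewrite (blockE bS).
by rewrite pE /= !lE.
Qed.
End Parity.

(** * Induction on the rank, and decompositions from constructions *)

Fixpoint exponent l r A := if r is r'.+1 then 2 * exponent l r' (A + 4 + l) else A.

(** Lowering the rank by one costs [4 + #|L|] for contracting pieces and a factor 2 for the parity
    split. *)
Lemma pre_chi_exp (V L : finType) r A (e : rel V) S (lam : V -> L) :
  symmetric e -> irreflexive e -> dec (pre r) A e S lam ->
  chi_exp (exponent #|L| r A) e S.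
Proof.
elim: r => [|r IH] in A e lam *.
  move=> se ie [] {lam}S lam b lamB h p bS gS lS _.
  (* Rank 0 is impossible as [L] contains [lam u]; so all blocks are singletons and no edge lies
     inside a block. *)
  apply: chi_exp_sub gS => // u v uS vS /=.
  case: (eqVneq (b u) (b v)) => [E|_]; last by rewrite andbT.
  rewrite andbF; apply/esym/negbTE/negP => uv.
  have u1 : 1 < #|b u|.
    apply/card_gt1P; exists u, v; rewrite (mem_block bS) // (blockE bS) // E eqxx.
    by split=> //; apply: contraTneq uv => ->; rewrite ie.
  have [[_]] := lS u uS u1; rewrite /rank leqn0 cards_eq0 => /eqP h0.
  by have := imset_f (h (b u)) (erefl : lam u \in L); rewrite h0 inE.
move=> se ie D.
have [e0 [e1 [b [s0 s1 [i0 i1] cov [D0 /odd_dec_mid D1]]]]] := pre_parity se ie D.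
apply: (chi_exp_union i0 i1 cov); apply: (IH _ _ lam).
- exact: s0.
- by move=> u; apply: contraFF (ie u) => /i0.
- by apply: cut_dec => //; apply: mid_cut.
- exact: s1.
- by move=> u; apply: contraFF (ie u) => /i1.
- by apply: cut_dec => //; apply: mid_cut.
Qed.

(* [R] and [g] account for the joins and renamings performed after [H] is built. *)
Lemma built_dec k (H : lgraph k) : built H ->
  forall (V : finType) (e : rel V) (i : H -> V) (R : rel 'I_k) (g : 'I_k -> 'I_k) lam,
  symmetric e -> irreflexive e -> injective i ->
  (forall x y, x != y -> e (i x) (i y) = edge x y || R (label x) (label y)) ->
  (forall x, lam (i x) = g (label x)) ->
  dec (pre k) 1 e [set i x | x in H] lam.
Proof.
have rk (h : 'I_k -> 'I_k) : rank h <= k.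
  by rewrite /rank (leq_trans (max_card _)) ?card_ord.
elim=> {H} [l|j l jl H _ IH|j l H jl _ IH|G H bG IHG bH IHH] V e i R g lam se ie inj_i eE lamE.
- have bS : blocks (fun u => [set u]) [set i x | x in single l].
    move=> u uS; apply/setP => v; rewrite in_set1 inE (inj_eq (@set1_inj V)).
    by case: eqP => [->|_]; rewrite ?uS // andbF.
  apply: (dec_intro bS); last by move=> u _; rewrite cards1.
  move=> U /subsetP US; apply: colors_omega_small.
  + exact: cross_sym.
  + exact: cross_irr.
  apply: omega_le => K /subsetP KU _; apply/card_le1_eqP => x y /KU/US + /KU/US.
  by move=> /imsetP[[] _ ->] /imsetP[[] _ ->].
- apply: (IH _ _ i (fun x y => [|| (x == j) && (y == l), (x == l) && (y == j) | R x y]) g) => //.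
  by move=> x y xy; rewrite eE //= /join_edge -!orbA.
- apply: (IH _ _ i (fun x y => R (if x == j then l else x) (if y == j then l else y))
    (fun x => g (if x == j then l else x))) => //.
set S := [set _ | _ in _].
(* The labels at the moment of the union, carried over to [V]; [lam v] is a default value off the
   image of [i]. *)
pose lab v := if [pick x | i x == v] is Some x then label x else lam v.
have labE x : lab (i x) = label x.
  by rewrite /lab; case: pickP => [y /eqP/inj_i->//|/(_ x)]; rewrite eqxx.
pose SG := [set i (inl x) | x in G]; pose SH := [set i (inr x) | x in H].
have inG x : i (inl x) \in SG by apply: imset_f.
have inH x : i (inr x) \in SH by apply: imset_f.
have GH x : i (inr x) \in SG = false by apply/negP => /imsetP[y _ /inj_i].
have HG x : i (inl x) \in SH = false by apply/negP => /imsetP[y _ /inj_i].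
have inS v : v \in S = (v \in SG) || (v \in SH).
  apply/imsetP/orP => [[[x|x] _ ->]|[/imsetP[x _ ->]|/imsetP[x _ ->]]]; auto.
  - by exists (inl x).
  - by exists (inr x).
have disj v : v \in SG -> v \in SH = false by case/imsetP => x _ ->; apply: HG.
have neq u : u \in S -> SG != SH.
  rewrite inS => uS; apply/eqP => E; have := disj u.
  by move: uS; rewrite E orbb => -> /(_ isT).
pose b v := if v \in SG then SG else SH.
have bS : blocks b S.
  move=> u uS; have {}neq := neq u uS; move: uS; rewrite inS => uS.
  apply/setP => v; rewrite inE inS.
  rewrite /b; move: uS (disj u) (disj v); case: (boolP (u \in SG)) => uG /= uH.
    case: (boolP (v \in SG)) => vG /= _; rewrite ?eqxx //.
    by rewrite eq_sym (negbTE neq) andbF.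
  move=> _; case: (boolP (v \in SG)) => vG /= => [->//|_].
    by rewrite (negbTE neq).
  by rewrite eqxx andbT.
have decG : dec (pre k) 1 e SG lab.
  rewrite /SG; apply: (IHG _ e (fun x => i (inl x)) R id) => //.
  - by move=> x y /inj_i[].
  - by move=> x y xy; rewrite eE.
have decH : dec (pre k) 1 e SH lab.
  apply: (IHH _ e (fun x => i (inr x)) R id) => //.
  - by move=> x y /inj_i[].
  - by move=> x y xy; rewrite eE.
apply: (dec_intro bS).
  move=> U US; set w := omega _ U.
  have sq : symmetric (cross e b) by apply: cross_sym.
  have iq : irreflexive (cross e b) by apply: cross_irr.
  case: (leqP w 1) => w1; first exact: colors_omega_small.
  (* With two blocks the cross edges form a bipartite graph, so exponent 1 is enough. *)
  apply: (@colors_leq _ _ _ 2); first by rewrite expn1.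
  exists (fun v => v \in SG); split=> [u _|u v _ _ /andP[_]]; first by case: (_ \in _).
  by rewrite /b; do 2!case: (_ \in SG); rewrite ?eqxx.
(* Edges across the union come only from [R], hence are determined by the labels at the children. *)
move=> u uS _; exists lab, g, id.
have lamS v : v \in S -> lam v = g (lab v).
  by case/imsetP => x _ ->; rewrite lamE labE.
split; last by rewrite /b; case: ifP.
split=> // [v vb|v v' w vb vb' wS wb E].
  exact/lamS/(subsetP (block_sub bS uS)).
move: vb vb' wS wb E; rewrite inS /b.
case: ifP => _ /imsetP[x _ ->] /imsetP[y _ ->] /orP[]/imsetP[z _ ->];
  by rewrite ?inG ?inH // !labE => _ /= E; rewrite !eE //= E.
Qed.

(** * Back to chromatic number and cliquewidth *)

Lemma colorable_clique_number (G : sgraph) A :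
  chi_exp A (@edge G) [set: G] -> colorable G (clique_number G ^ A).
Proof.
move=> /(_ _ (subxx _)) cG.
have {cG} [c [cm ce]] : colors (@edge G) [set: G] (clique_number G ^ A).
  apply: colors_leq cG; apply: leq_expn; apply: omega_le => K _ cK.
  exact: leq_bigmax_cond.
apply/existsP; exists [ffun u => Ordinal (cm u (in_setT u))].
apply/forallP => u; apply/forallP => v; apply/implyP => uv; rewrite !ffunE.
by rewrite -(inj_eq val_inj) ce ?inE.
Qed.

Lemma constructible_chi_exp k (G : sgraph) :
  constructible k G -> chi_exp (exponent k k 1) (@edge G) [set: G].
Proof.
move=> [L bL [h [h' hK h'K] hE]]; rewrite -{1}(card_ord k).
have -> : [set: G] = [set h x | x in L].
  by apply/setP => v; rewrite inE -[v]h'K imset_f.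
apply: (@pre_chi_exp _ _ _ _ _ _ (fun v => label (h' v))).
- exact: edge_sym.
- exact: edge_irr.
(* No operation follows the whole construction. *)
apply: (built_dec bL (R := fun _ _ => false) (g := id)) => [|||x y _|x].
- exact: edge_sym.
- exact: edge_irr.
- exact: (can_inj hK).
- by rewrite hE orbF.
- by rewrite hK.
Qed.

Theorem theorem1p1 (k : nat) :
  poly_chi_bounded (fun G : sgraph => cliquewidth G <= k).
Proof.
(* The cliquewidth may be any m up to [k]; the sum dominates the exponent of each. *)
pose A := \sum_(m < k.+1) exponent m m 1.
exists 'X^A%R => G; rewrite hornerXn -!natz -GRing.natrX !natz lez_nat.
rewrite /chromatic_number; case: ex_minnP => n _ n_min.
case: (posnP #|G|) => [G0 _|/card_gt0P[x _]].
  apply: (leq_trans (n_min 0 _)) => //; apply/existsP.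
  exists (ffun0 G0).
  by apply/forallP => u; have := card0_eq G0 u.
have w0 : 0 < clique_number G.
  rewrite -(cards1 x); apply: leq_bigmax_cond.
  by apply/cliqueP => u v /set1P-> /set1P->; rewrite eqxx.
rewrite /cliquewidth; case: ex_minnP => m /orP[/eqP/card0_eq/(_ x)//|/asboolP Gm] _ mk.
apply: (leq_trans (n_min _ (colorable_clique_number (constructible_chi_exp Gm)))).
apply: leq_pexp2l => //; have mk' : m < k.+1 by [].
by rewrite /A (bigD1 (Ordinal mk')) //= leq_addr.
Qed.
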